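(* Let $D_n=(N,A)$ be the complete digraph on $n\ge 3$ nodes and let $c=(c_1,\dots,c_m)$ be a cardinality sequence with $m\ge 2$. Then: (i) $\dim P_C^{c}(D_n)=(n-1)^2$. (ii) For every node $i\in N$, the degree inequality $x(\delta^{\mathrm{out}}(i))\le 1$ defines a facet of $P_C^{c}(D_n)$.
   Context: The complete digraph $D_n=(N,A)$ has node set $N=\{1,\dots,n\}$ and arc set $A=\{(i,j): i,j\in N, i\neq j\}$ (no loops, no parallel arcs). A cardinality sequence is a sequence of integers $c=(c_1,\dots,c_m)$ with $1\le c_1<c_2<\dots<c_m\le n$. $P_C^{c}(D_n)\subseteq\mathbb{R}^A$ is the convex hull of the incidence vectors $\chi^C$ of simple directed cycles $C$ of $D_n$ whose number of arcs $|C|$ equals $c_p$ for some $p\in\{1,\dots,m\}$. For $F\subseteq A$, $x(F)=\sum_{(i,j)\in F}x_{ij}$; $\delta^{\mathrm{out}}(i)$ is the set of arcs leaving node $i$.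
   Formalization: Sequences c = (1,k) are excluded: D_n has no loops, so no cycle has one arc, the polytope then lies in the hyperplane x(A) = k, and (i) fails (e.g. n = 3, c = (1,2) gives dimension 2, not 4). *)

(* Defs.v *)
From mathcomp Require Import all_boot all_order all_algebra.
From mathcomp Require Import boolp classical_sets reals.

Set Implicit Arguments.
Unset Strict Implicit.
Unset Printing Implicit Defensive.

Import Order.TTheory GRing.Theory Num.Theory.

Local Open Scope ring_scope.

Section Polyhedra.
Variables (R : realType) (V : lmodType R).
Local Open Scope classical_set_scope.

Definition convex_hull (S : set V) : set V :=
  [set x | exists (k : nat) (p : 'I_k -> V) (w : 'I_k -> R),
    [/\ forall i, S (p i), forall i, 0 <= w i, \sum_i w i = 1
      & x = \sum_i w i *: p i]].

Definition affine_indep (k : nat) (p : 'I_k -> V) : Prop :=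
  forall w : 'I_k -> R,
    \sum_i w i = 0 -> \sum_i w i *: p i = 0 -> forall i, w i = 0.

(* [has_dim S d]: the maximum size of an affinely independent family of points
   of S is d + 1. The empty set, of dimension -1, has no dimension here. *)
Definition has_dim (S : set V) (d : nat) : Prop :=
  (exists p : 'I_d.+1 -> V, affine_indep p /\ forall i, S (p i)) /\
  (forall (k : nat) (p : 'I_k -> V),
     affine_indep p -> (forall i, S (p i)) -> (k <= d.+1)%N).

Lemma has_dim_inj (S : set V) (d d' : nat) :
  has_dim S d -> has_dim S d' -> d = d'.
Proof.
move=> [[p [ip Sp]] maxd] [[p' [ip' Sp']] maxd'].
by apply/eqP; rewrite eqn_leq -ltnS (maxd' _ p) //= -ltnS (maxd _ p').
Qed.

Definition valid_ineq (P : set V) (f : V -> R) (b : R) : Prop :=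
  forall x, P x -> f x <= b.

Definition induced_face (P : set V) (f : V -> R) (b : R) : set V :=
  [set x | P x /\ f x = b].

Definition facet_defining (P : set V) (f : V -> R) (b : R) : Prop :=
  valid_ineq P f b /\
  exists d, has_dim P d.+1 /\ has_dim (induced_face P f b) d.

End Polyhedra.

(* The nodes 1, ..., n of D_n are represented by the elements 0, ..., n-1
   of 'I_n. *)
Definition diarc (n : nat) := {a : 'I_n * 'I_n | a.1 != a.2}.

Definition arc_tail (n : nat) (a : diarc n) : 'I_n := (val a).1.
Definition arc_head (n : nat) (a : diarc n) : 'I_n := (val a).2.

Definition delta_out (n : nat) (i : 'I_n) : {set diarc n} :=
  [set a | arc_tail a == i].

(* A simple directed cycle is the set of arcs joining each node of a nonempty
   duplicate-free cyclic sequence s to its successor. A singleton s is not an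
   [ucycle] for this irreflexive relation. *)
Definition dicycle (n : nat) (C : {set diarc n}) : Prop :=
  exists s : seq 'I_n,
    [/\ s != [::], ucycle (fun i j => i != j) s
      & C = [set a | (arc_tail a \in s) && (arc_head a == next s (arc_tail a))]].

(* The entry 1 is allowed, although D_n, being loopless, has no cycle with
   a single arc. *)
Definition cardinality_sequence (n m : nat) (c : m.-tuple nat) : Prop :=
  sorted ltn c /\ all (fun k => 1 <= k <= n)%N c.

(* R^A, for A the arc set of D_n. *)
Notation arc_space R n := {ffun diarc n -> R^o}.

Definition incidence (R : realType) (n : nat) (C : {set diarc n}) :
  arc_space R n := [ffun a => (a \in C)%:R].

Definition arc_sum (R : realType) (n : nat) (F : {set diarc n})
  (x : arc_space R n) : R := \sum_(a in F) x a.

Definition cycle_polytope (R : realType) (n m : nat) (c : m.-tuple nat) :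
  set (arc_space R n) :=
  convex_hull [set x | exists C : {set diarc n},
    [/\ dicycle C, #|C| \in c & x = incidence R C]]%classic.
Arguments cycle_polytope R n {m} c.

(* Main.v *)
(** Fix a node i and two admissible lengths 2 <= k < l. A circulation is
    determined by its values on the (n - 1)^2 arcs that do not enter i, which
    gives the upper bounds on both dimensions. For the lower bounds it suffices
    that the cycles of length k or l through i span, after restriction to these
    arcs, the whole space; together with one cycle of length k avoiding i they
    then affinely span a space of dimension (n - 1)^2.

    By duality, let Y be an arc weight that vanishes on the arcs entering i and
    on all cycles of length k or l through i, and put p = k - 1, q = l - 1.
    Every path on p or q nodes avoiding i, preceded by the arc from i to its
    first node, has weight 0. On a cycle t of q nodes avoiding i, of weight W,
    the q paths obtained by deleting one arc give Y u v = Y i v + W for each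
    arc (u, v) of t. Comparing two consecutive windows of p nodes of t shows
    that Y i v is a constant a, so that p a + (p - 1) W = 0 = q a + (q - 1) W;
    hence a = W = 0 and Y = 0. *)

Require Import Defs.
From mathcomp Require Import all_boot all_order all_algebra.
From mathcomp Require Import boolp classical_sets reals.
From mathcomp Require Import zify.

Set Implicit Arguments.
Unset Strict Implicit.
Unset Printing Implicit Defensive.

Import Order.TTheory GRing.Theory Num.Theory.

Local Open Scope ring_scope.

(** * Weights of cyclic sequences and of paths *)

Section CycleWeights.
Variables (T : eqType) (V : nmodType).
Implicit Types (Y : T -> T -> V) (s : seq T) (x y : T).

Lemma map_next s : uniq s -> map (next s) s = rot 1 s.
Proof.
case: s => // x s us; apply: (@eq_from_nth _ x).
  by rewrite size_map size_rot.
move=> i; rewrite size_map => lti.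
rewrite (nth_map x) // next_nth mem_nth // index_uniq // rot1_cons.
rewrite nth_rcons; case: ltngtP => [//|/=|->]; last by rewrite nth_default.
by rewrite ltnNge -ltnS lti.
Qed.

Definition cycle_weight Y s : V := \sum_(v <- s) Y v (next s v).

Fixpoint path_weight Y x s : V :=
  if s is y :: s' then Y x y + path_weight Y y s' else 0.

Lemma path_weight_rcons Y x s y :
  path_weight Y x (rcons s y) = path_weight Y x s + Y (last x s) y.
Proof. by elim: s x => [|z s IHs] x /=; rewrite ?addr0 ?add0r // IHs addrA. Qed.

Lemma cycle_weight_cons Y x s : uniq (x :: s) ->
  cycle_weight Y (x :: s) = path_weight Y x s + Y (last x s) x.
Proof.
move=> us; rewrite -path_weight_rcons /cycle_weight.
transitivity (\sum_(p <- zip (x :: s) (rcons s x)) Y p.1 p.2).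
  by rewrite -rot1_cons -(map_next us) -[X in zip X _]map_id zip_map big_map.
(* Only the starting node is generalised; the closing node [x] stays fixed in the induction. *)
move: {1 3}x; elim: s {us} => [|z s IHs] y /=; first by rewrite big_cons big_nil.
by rewrite big_cons IHs.
Qed.

Lemma cycle_weight_rot Y i s : uniq s ->
  cycle_weight Y (rot i s) = cycle_weight Y s.
Proof.
move=> us; rewrite /cycle_weight (perm_big s) /=; last by rewrite perm_rot.
by apply: eq_bigr => v _; rewrite next_rot.
Qed.

End CycleWeights.

Lemma next_rot_to (T : eqType) (s : seq T) x : uniq s -> (1 < size s)%N ->
  x \in s -> exists i y s', [/\ rot i s = x :: y :: s', x != y & next s x = y].
Proof.
move=> us s1 /rot_to[i s' def_s].
have: uniq (rot i s) by rewrite rot_uniq.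
have: (1 < size (rot i s))%N by rewrite size_rot.
rewrite def_s; case: s' def_s => // y s' def_s _.
rewrite /= inE negb_or => /andP[/andP[xy _] _].
by exists i, y, s'; split=> //; rewrite -(next_rot i us) def_s /= eqxx.
Qed.

Lemma ucycle_neq (T : eqType) (s : seq T) : uniq s -> (1 < size s)%N ->
  ucycle (fun x y => x != y) s.
Proof.
move=> us s1; rewrite /ucycle us andbT; apply: cycle_from_next => // x xs.
by have [i [y [s' [_ xy ->]]]] := next_rot_to us s1 xs.
Qed.

Lemma exists_uniq_seq (T : finType) (A : {set T}) r : (r <= #|A|)%N ->
  exists s, [/\ uniq s, size s = r & {subset s <= A}].
Proof.
move=> rA; exists (take r (enum A)); split; first by rewrite take_uniq ?enum_uniq.
  by rewrite size_take -cardE; case: ltngtP rA.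
by move=> x /mem_take; rewrite mem_enum.
Qed.

(** * Arc weights vanishing on all cycles of two lengths through a root *)

Section VanishingWeights.
Variables (T : finType) (F : numFieldType) (o : T) (Y : T -> T -> F).
Variables p q : nat.
Hypothesis p0 : (0 < p)%N.
Hypothesis pq : (p < q)%N.
Hypothesis qT : (q < #|T|)%N.
Hypothesis Yo : forall v, Y v o = 0.
Hypothesis Ycycle : forall s, uniq s -> o \in s ->
  size s \in [:: p.+1; q.+1] -> cycle_weight Y s = 0.

(** Prefixing [o] closes the path into a cycle whose last arc enters [o] and weighs 0. *)
Let path_eq0 x s : uniq (x :: s) -> o \notin x :: s ->
  size (x :: s) \in [:: p; q] -> Y o x + path_weight Y x s = 0.
Proof.
move=> us os hs; have uos : uniq (o :: x :: s) by rewrite cons_uniq os.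
have := @Ycycle (o :: x :: s) uos; rewrite cycle_weight_cons // Yo addr0.
by apply; rewrite ?mem_head // !inE /= !eqSS; move: hs; rewrite !inE.
Qed.

Let good t := [/\ uniq t, o \notin t & size t = q].

Let good_edge t u : good t -> u \in t ->
  Y u (next t u) = Y o (next t u) + cycle_weight Y t.
Proof.
move=> [ut ot st] tu.
have [|i [w [s [def_t uw ->]]]] := next_rot_to ut _ tu.
  by rewrite st; apply: leq_trans pq.
have us : uniq (u :: w :: s) by rewrite -def_t rot_uniq.
(* Rotating once more moves the arc from [u] to [w] to the closing position; deleting it leaves a
   path on all q nodes. *)
have ur : uniq (w :: rcons s u) by rewrite -rcons_cons -rot1_cons rot_uniq.
have /= := @path_eq0 w (rcons s u) ur.
rewrite -(cycle_weight_rot Y i ut) def_t -(cycle_weight_rot Y 1 us) rot1_cons /=.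
rewrite cycle_weight_cons // last_rcons => E.
have {E} := E _ _; rewrite addrA => ->; rewrite ?add0r //.
  by rewrite -rcons_cons -rot1_cons mem_rot -def_t mem_rot.
by rewrite size_rcons !inE -st -(size_rot i t) def_t eqxx orbT.
Qed.

(** Each arc is charged to its head plus a constant [W], and [Y o x] pays for the first node. This
    eliminates path weights in favour of root weights. *)
Let path_sum W x s : path (fun u v => Y u v == Y o v + W) x s ->
  Y o x + path_weight Y x s = \sum_(v <- x :: s) Y o v + W *+ size s.
Proof.
elim: s x => [|y s IHs] x /=; first by rewrite big_seq1.
case/andP=> /eqP-> /IHs IH.
by rewrite [_ + W + _]addrAC IH [in RHS]big_cons mulrSr !addrA.
Qed.

(** At least q - 2 nodes lie outside {o, u, v}, enough to fill the other places of the cycle.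
    Prescribing [r] fixes how far [v] comes after [u]. *)
Let exists_good u v r : u != v -> u != o -> v != o -> (r < q.-1)%N ->
  exists t1 t2, good (u :: t1 ++ v :: t2) /\ size t1 = r.
Proof.
move=> uv uo vo rq.
have [|s [us ss sA]] := @exists_uniq_seq _ (~: [set o; u; v]) q.-2.
  have := cardsC [set o; u; v]; rewrite -finset.setUA cardsU1 cards2 !inE.
  rewrite [o == u]eq_sym [o == v]eq_sym (negbTE uo) (negbTE vo) uv /= => cT.
  by move: qT; rewrite -cT; lia.
exists (take r s), (drop r s); split; last by rewrite size_takel // ss; lia.
have pm : perm_eq (u :: take r s ++ v :: drop r s) [:: u, v & s].
  by rewrite perm_cons -cat1s perm_catCA cat1s cat_take_drop.
have sN x : x \in [set o; u; v] -> x \notin s.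
  by move=> xA; apply/negP => /sA; rewrite inE xA.
split; last by rewrite (perm_size pm) /= ss; lia.
  by rewrite (perm_uniq pm) /= us inE negb_or uv !sN // !inE eqxx ?orbT.
by rewrite (perm_mem pm) !inE !negb_or eq_sym uo eq_sym vo sN // !inE eqxx.
Qed.

Let path_good x s1 s2 : good (x :: s1 ++ s2) ->
  size (x :: s1) \in [:: p; q] ->
  \sum_(v <- x :: s1) Y o v + cycle_weight Y (x :: s1 ++ s2) *+ size s1 = 0.
Proof.
move=> gt hs; have [ut ot _] := gt.
rewrite -path_sum; first last.
  have: cycle (fun u v => Y u v == Y o v + cycle_weight Y (x :: s1 ++ s2))
    (x :: s1 ++ s2).
    by apply: cycle_from_next => // u tu; rewrite -good_edge.
  by rewrite /= rcons_cat cat_path => /andP[].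
apply: path_eq0 => //; move: ut ot; rewrite -cat_cons ?cat_uniq ?mem_cat.
  by case/andP.
by rewrite negb_or => _ /andP[].
Qed.

Let root_const u v : u != o -> v != o -> Y o u = Y o v.
Proof.
have [-> //|uv] := eqVneq u v; move=> uo vo.
(* With p - 1 nodes in between, [u :: t1] and [rcons t1 v] are consecutive windows of p nodes. Both
   relations contain p - 1 copies of the cycle weight, so their difference compares [Y o u] with
   [Y o v]. For p = 1 the windows are single nodes. *)
have [|t1 [t2 [gt st1]]] := @exists_good u v p.-1 uv uo vo; first by lia.
have gt' : good (rot 1 (u :: t1 ++ v :: t2)).
  by case: gt => ut ot st; split; rewrite ?rot_uniq ?mem_rot ?size_rot.
have [ut _ _] := gt.
have := @path_good u t1 (v :: t2) gt; rewrite -(cycle_weight_rot Y 1 ut).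
move: gt'; rewrite rot1_cons rcons_cat rcons_cons.
case: t1 st1 {gt ut} => [|w t1] st1 gt'.
  have p1 : p = 1%N by move: st1 => /=; lia.
  have := @path_good v [::] (rcons t2 u) gt'.
  by rewrite !inE /= p1 eqxx !big_seq1 !mulr0n !addr0 => -> // ->.
move: gt'; rewrite /= -cat_rcons => gt'.
have := @path_good w (rcons t1 v) (rcons t2 u) gt'.
have sp : p = (size t1).+2 by move: st1 => /=; lia.
rewrite !inE /= size_rcons sp eqxx /= => /(_ isT) E1 /(_ isT) E2.
have := etrans E2 (esym E1); rewrite !big_cons => /addIr.
by rewrite -cats1 big_cat big_seq1 /= [RHS]addrA [LHS]addrC => /addrI.
Qed.

Let good_zero x s : good (x :: s) ->
  Y o x = 0 /\ cycle_weight Y (x :: s) = 0.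
Proof.
move=> gt; have [_ ot st] := gt.
set a := Y o x; set W := cycle_weight Y (x :: s).
have sum_a s' : {subset s' <= x :: s} -> \sum_(v <- s') Y o v = a *+ size s'.
  move=> s's; rewrite (eq_big_seq (fun=> a)); last first.
    move=> v /s's tv; apply: root_const; last by case/norP: ot; rewrite eq_sym.
    by apply: contraNneq ot => <-.
  by rewrite big_const_seq count_predT iter_addr_0.
have Eq : a *+ q + W *+ q.-1 = 0.
  move: (@path_good x s [::]); rewrite cats0 -/W => /(_ gt).
  by rewrite st !inE eqxx orbT sum_a // st => /(_ isT); rewrite -st.
have Ep : a *+ p + W *+ p.-1 = 0.
  have ss : size (take p.-1 s) = p.-1.
    by rewrite size_takel //; move: st => /=; lia.
  move: (@path_good x (take p.-1 s) (drop p.-1 s)).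
  rewrite cat_take_drop -/W /= ss prednK // => /(_ gt); rewrite !inE eqxx sum_a.
    by rewrite /= ss prednK // => /(_ isT).
  by move=> v; rewrite !inE => /orP[->//|/mem_take->]; rewrite orbT.
(* Subtracting [Ep] from [Eq] leaves q - p copies of a + W, and the characteristic is 0. *)
have aW : a + W = 0.
  have : (a + W) *+ (q - p) = 0.
    have key r d : (a + W) *+ d =
        (a *+ (d + r.+1) + W *+ (d + r)) - (a *+ r.+1 + W *+ r).
      by apply/esym/eqP; rewrite subr_eq mulrnDl !mulrnDr addrACA.
    rewrite (key p.-1) prednK //.
    have -> : (q - p + p.-1 = q.-1)%N by lia.
    have -> : (q - p + p = q)%N by lia.
    by rewrite Eq Ep subr0.
  by move/eqP; rewrite mulrn_eq0 subn_eq0 leqNgt pq => /eqP.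
(* [Ep] regroups as a + (p - 1)(a + W) = 0. *)
have a0 : a = 0.
  move: Ep; have -> : p = p.-1.+1 by lia.
  by rewrite /= mulrSr -addrA addrCA addrA -addrA -mulrnDl aW mul0rn addr0.
by split=> //; move: aW; rewrite a0 add0r.
Qed.

Lemma edge_weight_eq0 u v : u != v -> Y u v = 0.
Proof.
move=> uv; have [->|vo] := eqVneq v o; first exact: Yo.
have [uo|uo] := eqVneq u o; last first.
  (* Taking [r] = 0 makes [v] the successor of [u], so that [good_edge] applies to this arc. *)
  have [|t1 [t2 [gt /eqP]]] := @exists_good u v 0 uv uo vo.
    by rewrite -subn1 subn_gt0; apply: leq_trans pq.
  rewrite size_eq0 => /eqP t10; move: gt; rewrite t10 /= => gt.
  have := good_edge gt (mem_head _ _); have [_ ->] := good_zero gt.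
  rewrite /= eqxx addr0 => ->; rewrite (root_const vo uo).
  by have [] := good_zero gt.
(* For [u] = [o], a third node is needed to put [v] on a good cycle; it exists as #|T| > q > p >
   0. *)
have [w] : exists w, w \in ~: [set o; v].
  apply/finset.set0Pn; rewrite -card_gt0.
  by move: qT; rewrite -(cardsC [set o; v]) cards2; case: (_ != _) => /=; lia.
rewrite !inE negb_or => /andP[wo wv].
rewrite eq_sym in wv; have [|t1 [t2 [gt _]]] := @exists_good v w 0 wv vo wo.
  by rewrite -subn1 subn_gt0; apply: leq_trans pq.
by rewrite uo; have [] := good_zero gt.
Qed.
End VanishingWeights.

(** * Linear independence of row vectors *)

Section LinearIndependence.
Variables (F : fieldType) (d : nat).

Lemma sum_scale_rows k (w : 'I_k -> F) (r : 'I_k -> 'rV[F]_d) :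
  \sum_i w i *: r i = (\row_i w i) *m (\matrix_i r i).
Proof.
rewrite mulmx_sum_row; apply: eq_bigr => i _.
by rewrite mxE rowK.
Qed.

Lemma free_rows_leq k (r : 'I_k -> 'rV[F]_d) :
  (forall w : 'I_k -> F, \sum_i w i *: r i = 0 -> forall i, w i = 0) ->
  (k <= d)%N.
Proof.
move=> fr; suff /eqP <- : row_free (\matrix_i r i) by apply: rank_leq_col.
apply: inj_row_free => v v0; apply/rowP => i; rewrite mxE.
apply: (fr (v 0)); rewrite sum_scale_rows -[RHS]v0; congr (_ *m _).
by apply/rowP => j; rewrite mxE.
Qed.
End LinearIndependence.

(** * Arc sets of simple cycles *)

Section CycleArcs.
Variable n : nat.
Implicit Types (s : seq 'I_n) (a : diarc n) (C : {set diarc n}).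

Definition cycle_arcs s : {set diarc n} :=
  [set a | (arc_tail a \in s) && (arc_head a == next s (arc_tail a))].

(** Grouping arcs by tail leaves exactly one arc for each node of [s]. *)
Lemma sum_cycle_arcs (V : nmodType) (F : 'I_n -> 'I_n -> V) s :
  uniq s -> (1 < size s)%N ->
  \sum_(a in cycle_arcs s) F (arc_tail a) (arc_head a) = cycle_weight F s.
Proof.
move=> us s1; rewrite (partition_big (@arc_tail n) (mem s)) /=; last first.
  by move=> a; rewrite inE => /andP[].
rewrite /cycle_weight big_uniq //=; apply: eq_bigr => v sv.
have vn : v != next s v by have [i [y [s' [_ ? ->]]]] := next_rot_to us s1 sv.
rewrite (big_pred1 (exist _ (v, next s v) vn : diarc n)) //.
case=> [[x y] xy]; rewrite inE [RHS](_ : _ = ((x, y) == (v, next s v))) //=.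
rewrite /arc_tail /arc_head /= xpair_eqE.
case: (eqVneq x v) => [->|_]; last by rewrite andbF.
by rewrite sv andbT.
Qed.

Lemma card_cycle_arcs s : uniq s -> (1 < size s)%N -> #|cycle_arcs s| = size s.
Proof.
move=> us s1; rewrite -sum1_card (sum_cycle_arcs (V := nat) (fun _ _ => 1%N)) //.
by rewrite /cycle_weight sum1_size.
Qed.

Lemma dicycleP C : dicycle C <->
  exists s, [/\ uniq s, (1 < size s)%N & C = cycle_arcs s].
Proof.
split=> [[s [s0 /andP[cs us] ->]]|[s [us s1 ->]]]; exists s; split=> //.
- by case: s s0 cs {us} => [|x [|y s]] //=; rewrite eqxx.
- by case: s s1 {us}.
- exact: ucycle_neq.
Qed.
End CycleArcs.

(** * Circulations and their coordinates on the arcs not entering a node *)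

Definition delta_in (n : nat) (i : 'I_n) : {set diarc n} :=
  [set a | arc_head a == i].

Section ArcSpace.
Variables (R : realType) (n : nat).
Implicit Types (s : seq 'I_n) (a : diarc n) (B C : {set diarc n}) (i v : 'I_n).
Implicit Type x : arc_space R n.

Lemma arc_sum_lincomb k (w : 'I_k -> R) (p : 'I_k -> arc_space R n) B :
  arc_sum B (\sum_j w j *: p j) = \sum_j w j * arc_sum B (p j).
Proof.
rewrite /arc_sum; under [RHS]eq_bigr do rewrite mulr_sumr.
rewrite exchange_big /=; apply: eq_bigr => a _; rewrite sum_ffunE.
by apply: eq_bigr => j _; rewrite ffunE.
Qed.

Lemma arc_sum_incidence B C :
  arc_sum B (incidence R C) = \sum_(a in C) (a \in B)%:R.
Proof.
rewrite /arc_sum big_mkcond [RHS]big_mkcond; apply: eq_bigr => a _ /=.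
by rewrite ffunE; case: (a \in B); case: (a \in C).
Qed.

Lemma sum_indicator_uniq s v : uniq s ->
  \sum_(u <- s) (u == v)%:R = (v \in s)%:R :> R.
Proof.
move=> us; rewrite -(count_uniq_mem v us) -sum1_count natr_sum [RHS]big_mkcond.
by apply: eq_bigr => u _ /=; case: (u == v).
Qed.

Lemma out_degree_cycle s v : uniq s -> (1 < size s)%N ->
  arc_sum (delta_out v) (incidence R (cycle_arcs s)) = (v \in s)%:R.
Proof.
move=> us s1; rewrite arc_sum_incidence.
under eq_bigr do rewrite inE.
rewrite (sum_cycle_arcs (fun u _ => (u == v)%:R)) //.
exact: sum_indicator_uniq.
Qed.

(** Listed along [s], the heads of the arcs form a rotation of [s]. *)
Lemma in_degree_cycle s v : uniq s -> (1 < size s)%N ->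
  arc_sum (delta_in v) (incidence R (cycle_arcs s)) = (v \in s)%:R.
Proof.
move=> us s1; rewrite arc_sum_incidence.
under eq_bigr do rewrite inE.
rewrite (sum_cycle_arcs (fun _ u => (u == v)%:R)) // /cycle_weight.
rewrite -(big_map (next s) predT (fun u => (u == v)%:R)) map_next //.
by rewrite sum_indicator_uniq ?rot_uniq // mem_rot.
Qed.

Definition circulation x :=
  forall v, arc_sum (delta_out v) x = arc_sum (delta_in v) x.

Lemma circulation_lincomb k (w : 'I_k -> R) (p : 'I_k -> arc_space R n) :
  (forall j, circulation (p j)) -> circulation (\sum_j w j *: p j).
Proof.
by move=> cp v; rewrite !arc_sum_lincomb; apply: eq_bigr => j _; rewrite cp.
Qed.

Definition arcs_avoiding i : {set diarc n} := [set a | arc_head a != i].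

(** Each of the n - 1 heads other than [i] has n - 1 possible tails. *)
Lemma card_arcs_avoiding i : #|arcs_avoiding i| = ((n - 1) ^ 2)%N.
Proof.
have -> : #|arcs_avoiding i| =
    #|[set e : 'I_n * 'I_n | (e.2 != i) && (e.1 != e.2)]|.
  rewrite -(card_imset _ val_inj); apply: eq_card => e; rewrite inE.
  apply/imsetP/andP => [[a]|[ei ee]].
    by rewrite inE => ai ->; split=> //; exact: valP a.
  by exists (exist _ e ee); rewrite ?inE.
transitivity (\sum_(u < n) \sum_(v < n | (v != i) && (u != v)) 1)%N.
  by rewrite pair_big_dep -sum1dep_card.
rewrite (exchange_big_dep (fun v => v != i)) //=; last by move=> u v _ /andP[].
rewrite (eq_bigr (fun=> n - 1)%N) => [|v vi].
  by rewrite sum_nat_const cardC1 card_ord subn1 -mulnn.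
by rewrite vi sum1_card cardC1 card_ord subn1.
Qed.

Definition restr i x : 'rV[R]_#|arcs_avoiding i| :=
  \row_j x (enum_val j).

Lemma restr_lincomb i k (w : 'I_k -> R) (p : 'I_k -> arc_space R n) :
  restr i (\sum_j w j *: p j) = \sum_j w j *: restr i (p j).
Proof.
apply/rowP => e; rewrite mxE sum_ffunE summxE; apply: eq_bigr => j _.
by rewrite ffunE !mxE.
Qed.

(** An arc entering [i] has a tail v other than [i]. All arcs entering v and all other arcs leaving
    v avoid [i] as head, so conservation at v forces the value 0. *)
Lemma restr_eq0 i x : circulation x -> restr i x = 0 -> x = 0.
Proof.
move=> cx r0; have x0 a : arc_head a != i -> x a = 0.
  move=> ai; have aA : a \in arcs_avoiding i by rewrite inE.
  by have /rowP/(_ (enum_rank_in aA a)) := r0; rewrite !mxE enum_rankK_in.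
apply/ffunP => a; rewrite ffunE.
have [ai|/x0//] := eqVneq (arc_head a) i.
have vi : arc_tail a != i by rewrite -ai; exact: valP a.
have := cx (arc_tail a); rewrite /arc_sum [RHS]big1; last first.
  by move=> b; rewrite inE => /eqP bv; apply: x0; rewrite bv.
rewrite (bigD1 a) ?inE //= big1 ?addr0 // => b; rewrite inE => /andP[/eqP bt ba].
apply: x0; apply: contraNneq ba => bi; apply/eqP/val_inj.
by rewrite [LHS]surjective_pairing [RHS]surjective_pairing; congr pair;
  [exact: bt | rewrite -/(arc_head b) bi -ai].
Qed.

(** A constant coordinate 1 in front of the restriction turns affine into linear independence, at
    the cost of one extra dimension. *)
Lemma affine_indep_circulation_leq i k (p : 'I_k -> arc_space R n) :
  affine_indep p -> (forall j, circulation (p j)) ->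
  (k <= ((n - 1) ^ 2).+1)%N.
Proof.
move=> ip cp; rewrite -(card_arcs_avoiding i) -add1n.
apply: (@free_rows_leq R _ _ (fun j => row_mx (const_mx 1) (restr i (p j)))).
move=> w; under eq_bigr do rewrite scale_row_mx.
move=> w0; apply: ip.
  have /(congr1 lsubmx)/rowP/(_ 0) := w0.
  rewrite !mxE summxE => E; rewrite -[RHS]E ?summxE; apply: eq_bigr => j _.
  by rewrite row_mxEl !mxE mulr1.
apply: (@restr_eq0 i); first exact: circulation_lincomb.
apply/rowP => e; rewrite restr_lincomb.
have /(congr1 rsubmx)/rowP/(_ e) := w0.
rewrite !mxE summxE => E; rewrite -[RHS]E ?summxE; apply: eq_bigr => j _.
by rewrite row_mxEr.
Qed.

(** Here the out-degree at [i] plays the part of the constant coordinate: a vanishing combination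
    already has weights summing to 0. *)
Lemma affine_indep_degree1_leq i k (p : 'I_k -> arc_space R n) :
  affine_indep p -> (forall j, circulation (p j)) ->
  (forall j, arc_sum (delta_out i) (p j) = 1) ->
  (k <= (n - 1) ^ 2)%N.
Proof.
move=> ip cp p1; rewrite -(card_arcs_avoiding i).
apply: (@free_rows_leq R _ _ (fun j => restr i (p j))) => w w0.
have wp0 : \sum_j w j *: p j = 0.
  apply: (@restr_eq0 i); first exact: circulation_lincomb.
  by rewrite restr_lincomb.
apply: ip => //; have := arc_sum_lincomb w p (delta_out i).
rewrite wp0 /arc_sum big1 => [|a _]; last by rewrite ffunE.
move=> E; rewrite [RHS]E; apply: eq_bigr => j _.
by rewrite -/(arc_sum _ _) p1 mulr1.
Qed.

Lemma exists_cycle_basis i (k l : nat) :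
  (1 < k)%N -> (k < l)%N -> (l <= n)%N ->
  exists s : 'I_((n - 1) ^ 2) -> seq 'I_n,
    (forall j, [/\ uniq (s j), i \in s j & size (s j) \in [:: k; l]]) /\
    forall w : 'I_((n - 1) ^ 2) -> R,
      \sum_j w j *: incidence R (cycle_arcs (s j)) = 0 -> forall j, w j = 0.
Proof.
move=> k1 kl ln; rewrite -(card_arcs_avoiding i).
pose good C s := [/\ uniq s, i \in s, size s \in [:: k; l] & C = cycle_arcs s].
(* The rows range over all arc sets, with zero rows for those that are not suitable cycles. *)
pose M : 'M[R]_(#|{set diarc n}|, #|arcs_avoiding i|) :=
  \matrix_r (if `[< exists s, good (enum_val r) s >]
             then restr i (incidence R (enum_val r)) else 0).
have fM : row_full M.
  rewrite /row_full -mxrank_tr; apply: inj_row_free => v vM.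
  (* A vector orthogonal to all rows is read as an arc weight, extended by 0 to the arcs entering
     [i]. *)
  pose Y u w := \sum_j v 0 j * (val (enum_val j) == (u, w))%:R.
  have Y0 u w : u != w -> Y u w = 0.
    apply: (@edge_weight_eq0 _ _ i Y k.-1 l.-1); rewrite ?card_ord; try lia.
      move=> x; rewrite /Y big1 // => j _.
      have := enum_valP j; rewrite inE /arc_head.
      case: (val (enum_val j)) => y z /= zi.
      by rewrite xpair_eqE (negbTE zi) andbF mulr0.
    move=> s us si; rewrite !prednK; try lia; move=> ss.
    have s1 : (1 < size s)%N by move: ss; rewrite !inE => /orP[]/eqP->; lia.
    rewrite -sum_cycle_arcs // exchange_big /=.
    have /rowP/(_ (enum_rank (cycle_arcs s))) := vM.
    rewrite !mxE => E; rewrite -[RHS]E ?summxE; apply: eq_bigr => j _.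
    rewrite !mxE enum_rankK.
    rewrite asboolT; last by exists s.
    rewrite mxE ffunE -mulr_sumr; congr (_ * _).
    under eq_bigr do rewrite -surjective_pairing (inj_eq val_inj).
    have [jC|jC] := boolP (enum_val j \in _).
      rewrite (bigD1 (enum_val j)) //= eqxx big1 ?addr0 // => b /andP[_ bj].
      by rewrite eq_sym (negbTE bj).
    by rewrite big1 // => b bC; case: eqP => // jb; rewrite jb bC in jC.
  apply/rowP => j; rewrite mxE.
  have := Y0 (arc_tail (enum_val j)) (arc_head (enum_val j)) (valP (enum_val j)).
  rewrite /Y (bigD1 j) //= -surjective_pairing eqxx mulr1 big1 ?addr0 //.
  move=> j' j'j; rewrite val_eqE (inj_eq enum_val_inj).
  by rewrite (negbTE j'j) mulr0.
pose f := fullrankfun fM.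
have ff : row_free (rowsub f M) by apply: fullrowsub_free.
have lin w : \sum_j w j *: row (f j) M = 0 -> forall j, w j = 0.
  have -> : \sum_j w j *: row (f j) M = (\row_j w j) *m rowsub f M.
    by rewrite mulmx_sum_row; apply: eq_bigr => j _; rewrite row_rowsub mxE.
  rewrite -[RHS](mul0mx _ (rowsub f M)) => /(row_free_inj ff)/rowP e j.
  by have := e j; rewrite !mxE.
(* A selected row cannot be one of the zero rows, since the selected rows are independent. *)
have goodf j : exists s, good (enum_val (f j)) s.
  apply: contrapT => nj.
  have := lin (fun j' => (j' == j)%:R).
  rewrite (bigD1 j) //= big1 => [|j' /negbTE->]; last by rewrite scale0r.
  rewrite addr0 eqxx scale1r rowK asboolF // => /(_ erefl j)/eqP.
  by rewrite eqxx oner_eq0.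
have [s sP] := choice goodf; exists s; split=> [j|w w0].
  by have [] := sP j.
apply: lin; rewrite -[RHS](_ : restr i 0 = 0); last first.
  by apply/rowP => j; rewrite !mxE ffunE.
rewrite -w0 restr_lincomb; apply: eq_bigr => j _.
by rewrite rowK asboolT //; have [_ _ _ ->] := sP j.
Qed.

End ArcSpace.

(** * Dimensions of the cycle polytope and of its out-degree faces *)

Section CyclePolytope.
Variables (R : realType) (n m : nat) (c : m.-tuple nat).
Implicit Types (s : seq 'I_n) (x : arc_space R n).
Local Notation P := (cycle_polytope R n c).

Lemma incidence_in_polytope s : uniq s -> (1 < size s)%N -> size s \in c ->
  P (incidence R (cycle_arcs s)).
Proof.
move=> us s1 sc; exists 1%N, (fun=> incidence R (cycle_arcs s)), (fun=> 1).
split; rewrite ?big_ord1 ?scale1r //; move=> _.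
exists (cycle_arcs s); split=> //; last by rewrite card_cycle_arcs.
by apply/dicycleP; exists s.
Qed.

Lemma polytope_circulation x : P x -> circulation x.
Proof.
move=> [k [p [w [Sp _ _ ->]]]]; apply: circulation_lincomb => j v.
have [C [/dicycleP[s [us s1 ->]] _ ->]] := Sp j.
by rewrite out_degree_cycle // in_degree_cycle.
Qed.

Lemma polytope_out_degree_le1 i : valid_ineq P (arc_sum (delta_out i)) 1.
Proof.
move=> x [k [p [w [Sp w0 w1 ->]]]]; rewrite arc_sum_lincomb -w1.
apply: ler_sum => j _; rewrite ler_piMr //.
have [C [/dicycleP[s [us s1 ->]] _ ->]] := Sp j.
by rewrite out_degree_cycle // lern1 leq_b1.
Qed.

Variables (k l : nat).
Hypothesis k1 : (1 < k)%N.
Hypothesis kl : (k < l)%N.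
Hypothesis ln : (l <= n)%N.
Hypothesis kc : k \in c.
Hypothesis lc : l \in c.

Lemma exists_face_basis (i : 'I_n) :
  exists p : 'I_((n - 1) ^ 2) -> arc_space R n,
    (forall w : 'I_((n - 1) ^ 2) -> R,
       \sum_j w j *: p j = 0 -> forall j, w j = 0) /\
    forall j, induced_face P (arc_sum (delta_out i)) 1 (p j).
Proof.
have [s [sP fs]] := exists_cycle_basis R i k1 kl ln.
exists (fun j => incidence R (cycle_arcs (s j))); split=> // j.
have [us si ss] := sP j.
have [s1 sc] : (1 < size (s j))%N /\ size (s j) \in c.
  by move: ss; rewrite !inE => /orP[]/eqP->; split=> //; apply: ltn_trans kl.
by split; [apply: incidence_in_polytope | rewrite out_degree_cycle // si].
Qed.

Lemma cycle_polytope_dim : has_dim P ((n - 1) ^ 2)%N.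
Proof.
have n0 : (0 < n)%N by lia.
pose i := Ordinal n0; split; last first.
  by move=> r p ip Pp; apply: (affine_indep_circulation_leq i ip) => j;
    apply: polytope_circulation.
have [p [fp Fp]] := exists_face_basis i.
(* A cycle of length [k] can avoid [i] because k < l <= n. *)
have [|s [us ss sA]] := @exists_uniq_seq _ (~: [set i]) k.
  by have := cardsC1 i; rewrite card_ord; lia.
have s1 : (1 < size s)%N by rewrite ss.
have is0 : i \notin s by apply/negP => /sA; rewrite !inE eqxx.
pose x0 := incidence R (cycle_arcs s).
exists (fun j => if unlift ord0 j is Some j' then p j' else x0).
split=> [w w0|j]; last first.
  case: unliftP => [j' _|_]; first by have [] := Fp j'.
  by apply: incidence_in_polytope; rewrite ?ss.
rewrite big_ord_recl unlift_none.
under eq_bigr do rewrite liftK.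
move=> wp0; move: w0; rewrite big_ord_recl => w0.
(* The out-degree at [i] is 0 on [x0] and 1 on the other points. Hence the weights of the latter sum
   to 0, so [x0] has weight 0 too and linear independence finishes. *)
have W0 : \sum_j w (lift ord0 j) = 0.
  have := congr1 (arc_sum (delta_out i)) wp0.
  have arc_sumD (y z : arc_space R n) : arc_sum (delta_out i) (y + z) =
      arc_sum (delta_out i) y + arc_sum (delta_out i) z.
    by rewrite /arc_sum -big_split; apply: eq_bigr => a _; rewrite ffunE.
  have arc_sumZ b (y : arc_space R n) : arc_sum (delta_out i) (b *: y) =
      b * arc_sum (delta_out i) y.
    by rewrite /arc_sum mulr_sumr; apply: eq_bigr => a _; rewrite ffunE.
  rewrite arc_sumD arc_sumZ arc_sum_lincomb out_degree_cycle // (negbTE is0).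
  rewrite mulr0 add0r [X in _ = X]big1 => [E|a _]; last by rewrite ffunE.
  rewrite -[RHS]E; apply: eq_bigr => j _; have [_ ->] := Fp j.
  by rewrite mulr1.
have w00 : w ord0 = 0 by move: w0; rewrite W0 addr0.
move=> j; case: (unliftP ord0 j) => [j' ->|-> //].
by apply: (fp (fun j' => w (lift ord0 j'))); rewrite -[RHS]wp0 w00 scale0r add0r.
Qed.

(** Linearly independent points are affinely independent; (n - 1)^2 of them span dimension one less,
    hence the successor form of the hypothesis. *)
Lemma out_degree_face_dim (i : 'I_n) d : ((n - 1) ^ 2 = d.+1)%N ->
  has_dim (induced_face P (arc_sum (delta_out i)) 1) d.
Proof.
move=> nd; split; last first.
  move=> r p ip Fp; rewrite -nd; apply: (affine_indep_degree1_leq ip) => j.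
    by apply: polytope_circulation; have [] := Fp j.
  by have [_] := Fp j; apply.
have := exists_face_basis i; rewrite nd => -[p [fp Fp]].
by exists p; split=> // w _; apply: fp.
Qed.

End CyclePolytope.

(** * Choice of two cycle lengths, and the theorem *)

Lemma two_cycle_lengths n m (c : m.-tuple nat) : (1 < m)%N ->
  cardinality_sequence n c -> (forall k : nat, tval c <> [:: 1%N; k]) ->
  exists k l, [/\ (1 < k)%N, (k < l)%N, (l <= n)%N, k \in c & l \in c].
Proof.
move=> m1 [srt bnd] s_neq; have := size_tuple c.
suff: (1 < size c)%N -> exists k l,
  [/\ (1 < k)%N, (k < l)%N, (l <= n)%N, k \in tval c & l \in tval c].
  by move=> H sc; apply: H; rewrite sc.
case: (tval c) srt bnd s_neq => [|x [|y s]] //=.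
move=> /andP[xy srt] /and3P[bx by_ bs] s_neq _.
(* Only the first entry can be 1. If it is, the next two entries serve. In the excluded case (1, k)
   all cycles have k arcs, so the equation x(A) = k lowers the dimension. *)
have [x1|x1] := ltnP 1 x.
  by exists x, y; rewrite !inE !eqxx ?orbT; split=> //; case/andP: by_.
case: s srt bs s_neq => [|z s] /= srt bs s_neq.
  by case: (s_neq y); congr (_ :: _); lia.
case/andP: srt => yz _; case/andP: bs => bz _.
by exists y, z; rewrite !inE !eqxx ?orbT; split=> //; lia.
Qed.

Theorem theorem3 (R : realType) (n m : nat) (c : m.-tuple nat)
    (hn : (3 <= n)%N) (hm : (2 <= m)%N)
    (hc : cardinality_sequence n c)
    (hc1 : forall k : nat, tval c <> [:: 1%N; k]) :
  has_dim (cycle_polytope R n c) ((n - 1) ^ 2)%N /\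
  (forall i : 'I_n,
     facet_defining (cycle_polytope R n c) (arc_sum (delta_out i)) 1).
Proof.
have [k [l [k1 kl ln kc lc]]] := two_cycle_lengths hm hc hc1.
have dimP := cycle_polytope_dim R k1 kl ln kc lc.
split=> // i; split; first exact: polytope_out_degree_le1.
(* [facet_defining] asks for a dimension in successor form; (n - 1)^2 is positive as n >= 3. *)
have nd : ((n - 1) ^ 2 = ((n - 1) ^ 2).-1.+1)%N.
  by rewrite prednK // expn_gt0 subn_gt0 (ltn_trans _ hn).
exists ((n - 1) ^ 2).-1; split; first by rewrite -nd.
exact: out_degree_face_dim k1 kl ln kc lc _ _ nd.
Qed.
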